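(* Let $\rho$ be a state of exactly $M$ particles in total distributed among $N\ge 2$ parties, each party holding one or more local modes. If $M<N$, then the effective state of $\rho$ under the particle-number superselection rule, $$\tilde\rho=\sum_{n_1+\dots+n_N=M}\mathbf{\Pi}_{n_1,\dots,n_N}\,\rho\,\mathbf{\Pi}_{n_1,\dots,n_N},$$ is not genuinely multipartite entangled; i.e. whenever the superselection rule is enforced and $M<N$, effective genuinely multipartite entanglement vanishes.
   Context: The sum is over all $N$-tuples of non-negative integers $(n_1,\dots,n_N)$ summing to $M$, and $\mathbf{\Pi}_{n_1,\dots,n_N}=\bigotimes_{j=1}^N\Pi_{n_j}$, where $\Pi_{n_j}$ is the projector onto the $n_j$-particle subspace of party $j$'s (Fock) space (for a single mode per party, $\Pi_{n_j}=|n_j\rangle\langle n_j|$). The superselection rule allows only local measurements commuting with the local particle-number operators; $\tilde\rho$ has the same outcome statistics as $\rho$ for all such measurements. A pure state of $N$ parties is $k$-separable if it can be written as a tensor product $|\psi_1\rangle\otimes\dots\otimes|\psi_k\rangle$ of $k$ states, each on a nonempty set of parties, these sets partitioning the set of parties. A mixed state is $k$-separable if it is a convex combination of pure states each of which is at least $k$-separable (the partitions may differ from term to term). A state is genuinely multipartite entangled if it is not $k$-separable for any $k\ge2$. *)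

(* Defs.v *)
From HB Require Import structures.
From mathcomp Require Import all_boot all_order all_algebra.
From mathcomp Require Import complex.
From mathcomp Require Import all_classical all_reals all_analysis.

Set Implicit Arguments.
Unset Strict Implicit.
Unset Printing Implicit Defensive.

Import Order.TTheory GRing.Theory Num.Theory.

Local Open Scope classical_set_scope.
Local Open Scope ring_scope.

Inductive statistics := Boson | Fermion.

(* Occupation numbers of one mode: arbitrary for bosons, 0 or 1 for fermions. *)
Definition occupation (s : statistics) : choiceType :=
  match s with Boson => nat | Fermion => bool end.

Definition occupation_nat (s : statistics) : occupation s -> nat :=
  match s with Boson => fun n => n | Fermion => nat_of_bool end.

(* The occupation-number basis of the Fock space of [k] modes; the Fock space  *)
(* itself is the space of square-summable functions on this basis.             *)
Definition local_config (s : statistics) (k : nat) : choiceType :=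
  {ffun 'I_k -> occupation s}.

Definition particles (s : statistics) (k : nat) (a : local_config s k) : nat :=
  (\sum_(i < k) occupation_nat (a i))%N.

(* The product basis of the tensor product, over the parties in [T], of the    *)
(* Fock spaces of [m j] modes.  For fermions too this is the ordinary, not the *)
(* graded, tensor product.                                                     *)
Definition config (s : statistics) (T : finType) (m : T -> nat) : choiceType :=
  {dffun forall j : T, local_config s (m j)}.

Definition total_particles (s : statistics) (T : finType) (m : T -> nat)
    (c : config s m) : nat :=
  (\sum_(j : T) particles (c j))%N.

Definition block_config (s : statistics) (T : finType) (m : T -> nat)
    (S : {set T}) : choiceType :=
  config s (fun j : {j : T | j \in S} => m (val j)).

Definition restrict_config (s : statistics) (T : finType) (m : T -> nat)
    (S : {set T}) (c : config s m) : block_config s m S :=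
  [ffun j : {j : T | j \in S} => c (val j)].

(* Vectors of l^2(X), and operators on it given by their matrix elements       *)
(* [A x y] = <x|A|y> in the basis X.                                           *)
Definition vect (R : realType) (X : choiceType) := X -> R[i].
Definition operator (R : realType) (X : choiceType) := X -> X -> R[i].

Definition pure_state (R : realType) (X : choiceType) (psi : vect R X) : Prop :=
  (\esum_(x in [set: X])
     (complex.Re (psi x) ^+ 2 + complex.Im (psi x) ^+ 2)%:E = 1)%E.

Definition ketbra (R : realType) (X : choiceType) (psi : vect R X) :
    operator R X :=
  fun x y => psi x * (psi y)^*.

(* In R[i], [0 <= z] says that z is real and nonnegative, so positivity        *)
(* includes Hermiticity.                                                       *)
Definition positive_operator (R : realType) (X : choiceType)
    (A : operator R X) : Prop :=
  forall (n : nat) (x : 'I_n -> X) (a : 'I_n -> R[i]),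
    0 <= \sum_(i < n) \sum_(j < n) (a i)^* * A (x i) (x j) * a j.

(* Positive kernels of trace one are exactly the matrices of the density       *)
(* operators on l^2(X).                                                        *)
Definition state (R : realType) (X : choiceType) (rho : operator R X) : Prop :=
  positive_operator rho /\
  (\esum_(x in [set: X]) (complex.Re (rho x x))%:E = 1)%E.

(* The sum over the basis is a finite-support sum.  It is the operator product *)
(* whenever A has finitely supported rows or B finitely supported columns, as  *)
(* is the case when one of the factors is diagonal.                            *)
Definition opmul (R : realType) (X : choiceType) (A B : operator R X) :
    operator R X :=
  fun x z => \sum_(y \in [set: X]) A x y * B y z.

Definition number_projector {R : realType} {s : statistics} {k : nat} (n : nat) :
    operator R (local_config s k) :=
  fun a b => ((a == b) && (particles a == n))%:R.

Definition tensor_operator (R : realType) (s : statistics) (T : finType)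
    (m : T -> nat) (A : forall j : T, operator R (local_config s (m j))) :
    operator R (config s m) :=
  fun c d => \prod_(j : T) A j (c j) (d j).

Definition joint_projector {R : realType} {s : statistics} {N : nat}
    {m : 'I_N -> nat} (n : 'I_N -> nat) : operator R (config s m) :=
  tensor_operator (fun j : 'I_N => number_projector (n j)).

Definition exactly_particles (R : realType) (s : statistics) (T : finType)
    (m : T -> nat) (M : nat) (rho : operator R (config s m)) : Prop :=
  forall c d : config s m,
    rho c d != 0 -> total_particles c = M /\ total_particles d = M.

(* The entries of an N-tuple of sum M are at most M, hence the type 'I_M.+1.   *)
Definition effective_state (R : realType) (s : statistics) (N : nat)
    (m : 'I_N -> nat) (M : nat) (rho : operator R (config s m)) :
    operator R (config s m) :=
  fun c d =>
    \sum_(n : {ffun 'I_N -> 'I_M.+1} | (\sum_(j < N) (n j : nat) == M)%N)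
      opmul (opmul (joint_projector (fun j => n j)) rho)
            (joint_projector (fun j => n j)) c d.

(* [phi S] is the factor living on the block S; its values outside of the      *)
(* blocks of the partition are irrelevant.                                     *)
Definition pure_k_separable (R : realType) (s : statistics) (T : finType)
    (m : T -> nat) (k : nat) (psi : vect R (config s m)) : Prop :=
  exists P : {set {set T}},
    [/\ finset.partition P [set: T]%SET, #|P| = k &
      exists phi : forall S : {set T}, vect R (block_config s m S),
        (forall S : {set T}, S \in P -> pure_state (phi S)) /\
        (forall c : config s m, psi c = \prod_(S in P) phi S (restrict_config S c))].

Definition k_separable (R : realType) (s : statistics) (T : finType)
    (m : T -> nat) (k : nat) (rho : operator R (config s m)) : Prop :=
  exists (r : nat) (p : 'I_r -> R) (psi : 'I_r -> vect R (config s m)),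
    [/\ (forall i, 0 <= p i), \sum_(i < r) p i = 1,
        (forall i, pure_state (psi i) /\
           exists2 k' : nat, (k <= k')%N & pure_k_separable k' (psi i)) &
        (forall c d : config s m,
           rho c d = \sum_(i < r) (p i)%:C%C * ketbra (psi i) c d)].

Definition genuinely_multipartite_entangled (R : realType) (s : statistics)
    (T : finType) (m : T -> nat) (rho : operator R (config s m)) : Prop :=
  forall k : nat, (2 <= k)%N -> ~ k_separable k rho.

(* Main.v *)
Require Import Defs.
From HB Require Import structures.
From mathcomp Require Import all_boot all_order all_algebra.
From mathcomp Require Import complex.
From mathcomp Require Import all_classical all_reals all_analysis.
From mathcomp Require Import ring.

(* If M < N, every tuple (n_1, ..., n_N) of sum M has an entry n_j = 0.  The   *)
(* configurations with M particles are finitely many, so rho is a finite sum   *)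
(* of rank-one terms v v^*, and the effective state is the sum of the terms    *)
(* (Pi_n v)(Pi_n v)^*.  Each vector Pi_n v has some party j in the vacuum, so  *)
(* it factors as |vac>_j times a vector of the other parties; normalizing      *)
(* these vectors gives a mixture of 2-separable pure states.                   *)

Set Implicit Arguments.
Unset Strict Implicit.
Unset Printing Implicit Defensive.

Import Order.TTheory GRing.Theory Num.Theory.

Local Open Scope classical_set_scope.
Local Open Scope ring_scope.

(** Exact particle number confines [rho] to finitely many configurations, so no spectral theorem is
    needed: elimination on positive kernels ([positive_kernel_gram]) writes it as a finite sum of
    terms |v><v|. By [effective_stateE], the effective state replaces each v by its components in
    the blocks of fixed local particle numbers. As M < N, each such component has an empty party,
    which [vacuum_pure_2_separable] splits off as a tensor factor. The projections preserve the
    trace, so the squared norms of the components are weights of a convex combination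
    ([vacuum_mixture_separable]). *)

(** * Positive kernels and their Gram decomposition *)

Section PositiveKernels.
Variables (C : numClosedFieldType) (X : eqType).
Implicit Types (A : X -> X -> C) (x y : X).

(** This is [positive_operator] with an abstract closed field in place of [R[i]]; the two are
    convertible there. *)
Definition positive_kernel A : Prop :=
  forall (n : nat) (x : 'I_n -> X) (a : 'I_n -> C),
    0 <= \sum_(i < n) \sum_(j < n) (a i)^* * A (x i) (x j) * a j.

Lemma positive_kernel2 A x y (a b : C) : positive_kernel A ->
  0 <= a^* * A x x * a + a^* * A x y * b + (b^* * A y x * a + b^* * A y y * b).
Proof.
move=> /(_ 2%N (tnth [tuple x; y]) (tnth [tuple a; b])).
by rewrite !big_ord_recl !big_ord0 !addr0.
Qed.

Lemma positive_kernel_diag A x : positive_kernel A -> 0 <= A x x.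
Proof.
move=> /(positive_kernel2 x x 1 0).
by rewrite conjC0 conjC1 !(mul0r, mulr0, mul1r, mulr1, addr0).
Qed.

(* Polarization: the forms at (1, 1) and (1, i) are real. *)
Lemma positive_kernel_herm A x y : positive_kernel A -> A y x = (A x y)^*.
Proof.
move=> Apos; have Dr z : (A z z)^* = A z z.
  exact/CrealP/ger0_real/positive_kernel_diag.
have /ger0_real/CrealP := positive_kernel2 x y 1 1 Apos.
have /ger0_real/CrealP := positive_kernel2 x y 1 'i Apos.
rewrite !(rmorphD, rmorphM, rmorph1, conjCi, conjCK, rmorphN) /= !Dr.
rewrite !(mul1r, mulr1) => Hi H1.
have ii : 'i * 'i = -1 :> C by rewrite -expr2 sqrCi.
have two0 : 2 != 0 :> C by rewrite pnatr_eq0.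
apply: (mulfI two0); apply/subr0_eq.
move/eqP: H1; rewrite -subr_eq0 => /eqP H1.
move/eqP: Hi; rewrite -subr_eq0 => /eqP/(congr1 ( *%R 'i)); rewrite mulr0 => Hi.
(* Adding [H1] to 'i times the other relation cancels [A x y] and the conjugate of [A y x]. *)
have := congr2 +%R H1 Hi; rewrite addr0 => /(congr1 -%R); rewrite oppr0 => <-.
by rewrite conjCi; ring: ii.
Qed.

Lemma positive_kernel_null A x y : positive_kernel A -> A x x = 0 -> A x y = 0.
Proof.
move=> Apos Axx; apply/eqP/negPn/negP => z0.
have zz0 : A x y * (A x y)^* != 0 by rewrite mulf_neq0 ?conjC_eq0.
(* With [A x x = 0], the form at the coefficients [t * A x y] and 1 is 2t|A x y|^2 + A y y, affine
   in real t; this t makes it -1. *)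
pose t := - ((A y y + 1) / (2 * (A x y * (A x y)^*))).
have tr : t^* = t.
  apply/CrealP; rewrite rpredN rpred_div ?rpredD ?rpred1 //.
    exact/ger0_real/positive_kernel_diag.
  rewrite rpredM ?rpred_nat //; exact: ger0_real (mul_conjC_ge0 _).
have := positive_kernel2 x y (t * A x y) 1 Apos.
rewrite Axx (positive_kernel_herm x y Apos) rmorphM /= tr rmorph1.
suff -> : t * (A x y)^* * 0 * (t * A x y) + t * (A x y)^* * A x y * 1 +
   (1 * (A x y)^* * (t * A x y) + 1 * A y y * 1) = -1 by rewrite ler0N1.
by rewrite /t; field; rewrite conjC_eq0 z0.
Qed.

(** Completing the square: the new form at [a] is the form of [A] with the extra point [x0], whose
    coefficient [- (L / d)] is the minimizing one. *)
Lemma positive_kernel_schur A x0 : positive_kernel A -> A x0 x0 != 0 ->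
  positive_kernel (fun x y => A x y - A x x0 * A x0 y / A x0 x0).
Proof.
move=> Apos d0 n x a; set d := A x0 x0 in d0 *.
have dr : d^* = d by rewrite -(positive_kernel_herm x0 x0 Apos).
pose L := \sum_(j < n) A x0 (x j) * a j.
pose x' i := oapp x x0 (unlift (@ord0 n) i).
pose a' i := oapp a (- (L / d)) (unlift (@ord0 n) i).
have Lc : \sum_(i < n) (a i)^* * A (x i) x0 = L^*.
  rewrite rmorph_sum /=; apply: eq_bigr => i _.
  by rewrite rmorphM /= -(positive_kernel_herm x0 (x i) Apos) mulrC.
have := Apos n.+1 x' a'; congr (_ <= _).
have x'0 : x' ord0 = x0 by rewrite /x' unlift_none.
have x'S i : x' (lift ord0 i) = x i by rewrite /x' liftK.
have a'0 : a' ord0 = - (L / d) by rewrite /a' unlift_none.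
have a'S i : a' (lift ord0 i) = a i by rewrite /a' liftK.
rewrite big_ord_recl big_ord_recl x'0 a'0 -/d.
under eq_bigr do rewrite x'S a'S -mulrA.
rewrite -mulr_sumr -/L.
under [X in _ + X]eq_bigr => i _.
  rewrite big_ord_recl x'0 a'0 x'S a'S.
  under eq_bigr do rewrite x'S a'S.
  over.
rewrite big_split /= -mulr_suml Lc.
under [RHS]eq_bigr => i _.
  under eq_bigr => j _.
    rewrite (_ : _ * a j = (a i)^* * A (x i) (x j) * a j
      - (a i)^* * A (x i) x0 / d * (A x0 (x j) * a j)); last by ring.
    over.
  rewrite sumrB -mulr_sumr -/L.
  over.
rewrite sumrB -!mulr_suml Lc rmorphN rmorphM fmorphV /= dr.
by field.
Qed.

(* Cholesky elimination: subtracting the Schur rank-one term at [x] clears the *)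
(* row and the column of [x] and keeps the kernel positive.                    *)
Lemma positive_kernel_gram A (s : seq X) :
  positive_kernel A -> (forall x, x \notin s -> A x x = 0) ->
  exists vs : seq (X -> C), forall x y, A x y = \sum_(v <- vs) v x * (v y)^*.
Proof.
elim: s A => [|x0 s IHs] A Apos As.
  by exists [::] => x y; rewrite big_nil (positive_kernel_null _ Apos) ?As.
have [d0|d0] := eqVneq (A x0 x0) 0.
  apply: IHs => // x xs; have [->//|xx0] := eqVneq x x0.
  by rewrite As // inE negb_or xx0.
have [|vs Hvs] := IHs _ (positive_kernel_schur Apos d0).
  move=> x xs; have [->|xx0] := eqVneq x x0; first by rewrite mulfK ?subrr.
  have Axx : A x x = 0 by rewrite As // inE negb_or xx0.
  by rewrite Axx (positive_kernel_null _ Apos Axx) !mul0r subrr.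
pose r := sqrtC (A x0 x0).
have r_ge0 : 0 <= r by rewrite sqrtC_ge0 positive_kernel_diag.
exists ((fun x => A x x0 / r) :: vs) => x y; rewrite big_cons -Hvs.
rewrite rmorphM fmorphV /= (CrealP (ger0_real r_ge0)).
rewrite -(positive_kernel_herm y x0 Apos).
rewrite mulrACA -invfM -expr2 sqrtCK; ring.
Qed.

End PositiveKernels.

Lemma esum_finite_support (R : realType) (T : choiceType) (s : seq T)
    (f : T -> R) :
  uniq s -> (forall x, 0 <= f x) -> (forall x, x \notin s -> f x = 0) ->
  (\esum_(x in [set: T]) (f x)%:E)%E = (\sum_(x <- s) f x)%:E.
Proof.
move=> us f0 fs.
transitivity (\esum_(x in [set` s]) (f x)%:E)%E.
  rewrite [RHS]esum_mkcond; apply: eq_esum => x _.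
  rewrite mem_setE; case: ifPn => // xs; by rewrite fs.
rewrite esum_fset; [|exact: finite_seq|by move=> x _; rewrite lee_fin].
by rewrite -fsbig_seq // sumEFin.
Qed.

(** * Vacuum configurations and splitting off an empty party *)

Section Vacuum.
Variables (s : statistics) (T : finType) (m : T -> nat).
Implicit Types (c : config s m) (S : {set T}) (j : T).

Definition unoccupied : occupation s :=
  match s with Boson => 0%N | Fermion => false end.

Definition vacuum k : local_config s k := [ffun=> unoccupied].

Definition vacuum_config : config s m := [ffun j => vacuum (m j)].

Lemma particles_eq0 k (a : local_config s k) : particles a = 0%N -> a = vacuum k.
Proof.
move=> /eqP; rewrite /particles sum_nat_eq0 => /forallP /= a0.
apply/ffunP => i; have := a0 i; rewrite ffunE.
by rewrite /vacuum /unoccupied; move: (a i); case: (s) => [n|[]] // /eqP.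
Qed.

Lemma occupation_nat_inj : injective (@occupation_nat s).
Proof. by case: s => // -[] []. Qed.

Lemma finite_total_particles M :
  finite_set [set c : config s m | total_particles c = M].
Proof.
(* No mode holds more than M particles, so [inord] loses nothing on these configurations and [f]
   embeds them in a finite type. *)
pose f (c : config s m) := [ffun u : {j : T & 'I_(m j)} =>
  inord (occupation_nat (c (tag u) (tagged u))) : 'I_M.+1].
have le (c : config s m) j i :
      total_particles c = M -> (occupation_nat (c j i) < M.+1)%N.
  move=> <-; rewrite ltnS /total_particles (bigD1 j) //=.
  by rewrite /particles (bigD1 i) //= -addnA leq_addr.
pose A := [set c : config s m | total_particles c = M].
have finj : {in A &, injective f}.
  move=> c d; rewrite !inE /= => cM dM /ffunP fcd.
  apply/ffunP => j; apply/ffunP => i; apply: occupation_nat_inj.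
  have := congr1 val (fcd (Tagged (fun j => 'I_(m j)) i)).
  by rewrite !ffunE /= !inordK ?le.
by rewrite -/A -(eq_finite_set (inj_card_eq finj)); exact: finite_finset.
Qed.

(** Parties outside S get the vacuum; matching on [@idP] supplies the membership proof that the
    subtype requires. *)
Definition extend_config S (b : block_config s m S) : config s m :=
  [ffun j => if @idP (j \in S) is ReflectT jS then b (exist _ j jS)
             else vacuum (m j)].

Lemma extend_configK S : cancel (@extend_config S) (@restrict_config s T m S).
Proof.
move=> b; apply/ffunP => -[j jS]; rewrite !ffunE /=.
by case: {-}_ / idP => // jS'; rewrite (bool_irrelevance jS' jS).
Qed.

Lemma restrict_configK S c : (forall j, j \notin S -> c j = vacuum (m j)) ->
  extend_config (restrict_config S c) = c.
Proof.
move=> cS; apply/ffunP => j; rewrite ffunE.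
case: {-}_ / idP => [jS|/negP jS]; first by rewrite ffunE.
by rewrite cS.
Qed.

Lemma vacuum_pure_2_separable (R : realType) (psi : vect R (config s m)) j :
  (1 < #|T|)%N -> pure_state psi ->
  (forall c, psi c != 0 -> c j = vacuum (m j)) -> pure_k_separable 2 psi.
Proof.
move=> T_gt1 psi1 psi_j; pose Sj := [set j]%SET.
have SjC : Sj != finset.setC Sj.
  by apply/eqP => /setP/(_ j); rewrite !inE eqxx.
have SjC0 : (finset.setC Sj != finset.set0).
  by rewrite -card_gt0 cardsC1 -subn1 subn_gt0.
have SjCF : (finset.setC Sj == Sj) = false by rewrite eq_sym (negbTE SjC).
exists [set Sj; finset.setC Sj]%SET; split.
- have cov : finset.cover [set Sj; finset.setC Sj]%SET = [set: T]%SET.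
    by rewrite /finset.cover big_setU1 ?inE //= big_set1 finset.setUCr.
  rewrite /finset.partition /finset.trivIset cov eqxx big_setU1 ?inE //= big_set1.
  rewrite cardsT cards1 cardsC1 add1n prednK ?(ltnW T_gt1) // eqxx /=.
  by rewrite negb_or eq_sym -card_gt0 cards1 eq_sym SjC0.
- by rewrite finset.cards2 SjC.
(* The factor on {j} is the vacuum; the factor on the other parties is [psi] with party j set to the
   vacuum. *)
exists (fun S (b : block_config s m S) =>
  if S == Sj then (b == restrict_config S vacuum_config)%:R
  else psi (extend_config b)); split.
- move=> S; rewrite !inE => /orP[] /eqP ->.
    rewrite /pure_state eqxx.
    rewrite (esum_finite_support (s := [:: restrict_config Sj vacuum_config])) //.
    + by rewrite big_seq1 eqxx /= expr1n expr0n addr0.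
    + by move=> x; rewrite addr_ge0 ?sqr_ge0.
    + by move=> x; rewrite inE => /negPf -> /=; rewrite expr0n addr0.
  rewrite /pure_state SjCF -[RHS]psi1.
  (* [extend_config] is a bijection onto the configurations with j empty, which carry the whole norm
     of [psi]. *)
  rewrite -(@reindex_esum _ _ _ setT [set c : config s m | c j = vacuum (m j)]
    (@extend_config (finset.setC Sj))
    (fun c => (complex.Re (psi c) ^+ 2 + complex.Im (psi c) ^+ 2)%:E)).
    rewrite [LHS]esum_mkcond; apply: eq_esum => c _.
    case: ifPn => //; rewrite notin_setE /= => cj.
    have [-> /=|/psi_j //] := eqVneq (psi c) 0.
    by rewrite expr0n addr0.
  split.
  + move=> b _ /=; rewrite ffunE.
    by case: {-}_ / idP => // jS; exfalso; move: jS; rewrite !inE eqxx.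
  + by move=> b b' _ _; apply: can_inj; exact: extend_configK.
  + move=> c /= cj; exists (restrict_config (finset.setC Sj) c) => //.
    by apply: restrict_configK => i; rewrite !inE negbK => /eqP ->.
move=> c; rewrite big_setU1 ?inE //= big_set1 eqxx SjCF.
have [cj|cj] := eqVneq (c j) (vacuum (m j)).
  rewrite restrict_configK; last by move=> i; rewrite !inE negbK => /eqP ->.
  rewrite (_ : _ == _ = true) ?mul1r //; apply/eqP/ffunP => -[i iS].
  by rewrite !ffunE /=; move: (iS); rewrite inE => /eqP ->.
rewrite (_ : _ == _ = false) ?mul0r.
  by apply/eqP/negPn/negP => /psi_j /eqP; rewrite (negPf cj).
apply/negP => /eqP /ffunP /(_ (exist _ j (set11 j))).
by rewrite !ffunE /= => /eqP; rewrite (negPf cj).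
Qed.

End Vacuum.

Lemma Re_ketbra (R : realType) (X : choiceType) (psi : vect R X) x :
  complex.Re (ketbra psi x x) = complex.Re (psi x) ^+ 2 + complex.Im (psi x) ^+ 2.
Proof. by rewrite /ketbra; case: (psi x) => a b /=; rewrite !expr2; ring. Qed.

(** * Normalizing a sum of rank-one terms into a mixture *)

Lemma vacuum_mixture_separable (R : realType) (s : statistics) (T I : finType)
    (m : T -> nat) (F : seq (config s m)) (w : I -> vect R (config s m))
    (rho : operator R (config s m)) :
  uniq F -> (1 < #|T|)%N ->
  (forall i c, c \notin F -> w i c = 0) ->
  (forall i, exists j, forall c, w i c != 0 -> c j = vacuum s (m j)) ->
  (forall c d, rho c d = \sum_i ketbra (w i) c d) ->
  \sum_(c <- F) complex.Re (rho c c) = 1 ->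
  k_separable 2 rho.
Proof.
move=> uF T_gt1 wF w0 rhoE tr1.
pose nsq (z : R[i]) := complex.Re z ^+ 2 + complex.Im z ^+ 2.
have nsq_ge0 z : 0 <= nsq z by rewrite addr_ge0 ?sqr_ge0.
have nsqM a z : nsq (a%:C%C * z) = a ^+ 2 * nsq z.
  by rewrite /nsq; case: z => x y /=; rewrite !expr2; ring.
have [j0 _] : exists j0 : T, true by apply/card_gt0P; exact: ltnW.
pose p i := \sum_(c <- F) nsq (w i c).
have p_ge0 i : 0 <= p i by rewrite sumr_ge0.
(* Vectors of norm zero cannot be normalized; they get weight [0] and the     *)
(* vacuum as a dummy pure state.                                              *)
pose psi i : vect R (config s m) := if p i == 0
  then fun c => (c == vacuum_config s m)%:R
  else fun c => ((Num.sqrt (p i))^-1)%:C%C * w i c.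
exists #|I|, (fun k => p (enum_val k)), (fun k => psi (enum_val k)); split.
- by [].
- rewrite -(big_enum_val (A := predT) p) /p exchange_big /= -[RHS]tr1.
  apply: eq_bigr => c _; rewrite rhoE raddf_sum.
  by apply: eq_bigr => i _; rewrite /= Re_ketbra.
- move=> k; set i := enum_val k.
  suff [psi1 [j psij]] : pure_state (psi i) /\
      exists j, forall c, psi i c != 0 -> c j = vacuum s (m j).
    split=> //; exists 2%N => //; exact: vacuum_pure_2_separable psij.
  rewrite /psi; case: eqVneq => [pi0|pi0].
    split.
      rewrite /pure_state (esum_finite_support (s := [:: vacuum_config s m])) //.
      + by rewrite big_seq1 eqxx /= expr1n expr0n addr0.
      + by move=> x; exact: nsq_ge0.
      + by move=> x; rewrite inE => /negPf -> /=; rewrite expr0n addr0.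
    exists j0 => c; case: (c =P _) => [-> _|]; first by rewrite ffunE.
    by rewrite eqxx.
  split.
    rewrite /pure_state (esum_finite_support (s := F)) //; last first.
    + by move=> c cF; rewrite wF // mulr0 /= expr0n addr0.
    + by move=> x; exact: nsq_ge0.
    under eq_bigr => c _ do rewrite -/(nsq _) nsqM.
    by rewrite -mulr_sumr -/(p i) exprVn sqr_sqrtr // mulVf.
  have [j wj] := w0 i; exists j => c; rewrite mulf_eq0 negb_or => /andP[_].
  exact: wj.
move=> c d; rewrite rhoE -(big_enum_val (A := predT)
  (fun i => (p i)%:C%C * ketbra (psi i) c d)) /=.
apply: eq_bigr => i _; rewrite /psi; case: eqVneq => [pi0|pi0].
  (* A vector of weight 0 vanishes identically, so its dummy replacement contributes as little as it
     did. *)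
  have wi0 e : w i e = 0.
    have [eF|/wF//] := boolP (e \in F).
    move/eqP: pi0; rewrite psumr_eq0 // => /allP/(_ e eF) /=.
    rewrite paddr_eq0 ?sqr_ge0 // !sqrf_eq0 => /andP[/eqP + /eqP].
    by case: (w i e) => a b /= -> ->.
  by rewrite pi0 mul0r /ketbra wi0 mul0r.
have aV : (p i)%:C%C * ((Num.sqrt (p i))^-1)%:C%C * ((Num.sqrt (p i))^-1)%:C%C = 1.
  by rewrite -!rmorphM -mulrA -invfM -expr2 sqr_sqrtr // divff.
have aR : (((Num.sqrt (p i))^-1)%:C%C)^* = ((Num.sqrt (p i))^-1)%:C%C :> R[i].
  by rewrite conj_Creal // complex_real.
rewrite /ketbra rmorphM /= aR -[LHS]mul1r -aV; ring.
Qed.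

(** * Local particle numbers and the effective state *)

Definition in_block (s : statistics) (N : nat) (m : 'I_N -> nat)
    (n : 'I_N -> nat) (c : config s m) : bool :=
  [forall j, particles (c j) == n j].

Lemma joint_projectorE (R : realType) (s : statistics) (N : nat)
    (m : 'I_N -> nat) (n : 'I_N -> nat) (c d : config s m) :
  joint_projector (R := R) n c d = ((c == d) && in_block n c)%:R.
Proof.
rewrite /joint_projector /tensor_operator /number_projector /=.
rewrite -natr_prod; congr (_%:R).
have [[/eqP -> cn]|] := @andP (c == d) (in_block n c).
  by rewrite big1 // => j _; rewrite eqxx (forallP cn).
move=> cdn; suff /existsP[j /negPf cdj] :
    [exists j, ~~ ((c j == d j) && (particles (c j) == n j))].
  by rewrite (bigD1 j) //= cdj mul0n.
rewrite -negb_forall; apply/negP => /forallP cdn'; apply: cdn; split.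
  by apply/eqP/ffunP => j; have /andP[/eqP] := cdn' j.
by apply/forallP => j; have /andP[] := cdn' j.
Qed.

Lemma effective_stateE (R : realType) (s : statistics) (N M : nat)
    (m : 'I_N -> nat) (rho : operator R (config s m)) c d :
  effective_state M rho c d =
  \sum_(n : {ffun 'I_N -> 'I_M.+1} | (\sum_(j < N) (n j : nat) == M)%N)
    (in_block (fun j => n j) c && in_block (fun j => n j) d)%:R * rho c d.
Proof.
apply: eq_bigr => n _; rewrite /opmul.
rewrite -(fsbig_widen [set d] setT) ?fsbig_set1; [|by []|]; last first.
  move=> y [_ /= /eqP yd]; by rewrite joint_projectorE (negPf yd) mulr0.
rewrite -(fsbig_widen [set c] setT) ?fsbig_set1; [|by []|]; last first.
  move=> y [_ /= /eqP yc]; by rewrite joint_projectorE eq_sym (negPf yc) mul0r.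
by rewrite !joint_projectorE !eqxx /= mulrAC -natrM mulnb.
Qed.

Theorem theorem5p1 (R : realType) (s : statistics) (N M : nat)
    (m : 'I_N -> nat) (rho : operator R (config s m)) :
  (2 <= N)%N ->
  (forall j : 'I_N, (0 < m j)%N) ->
  state rho ->
  exactly_particles M rho ->
  (M < N)%N ->
  ~ genuinely_multipartite_entangled (effective_state M rho).
Proof.
move=> N_ge2 _ [rho_pos rho1] rhoM ltMN /(_ 2%N isT); apply.
have /finite_seqP[F0 F0E] := @finite_total_particles s _ m M.
pose F := undup F0.
have uF : uniq F := undup_uniq F0.
have inF c : (c \in F) = (total_particles c == M).
  rewrite mem_undup; apply/idP/eqP => cM.
    by have : [set` F0] c by []; rewrite -F0E.
  by have : [set c | total_particles c = M] c by []; rewrite F0E.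
have rhoF c : c \notin F -> rho c c = 0.
  rewrite inF => cM; apply/eqP/negPn/negP => /rhoM[/eqP].
  by rewrite (negPf cM).
have [vs rhoE] := positive_kernel_gram (A := rho) (s := F) rho_pos rhoF.
(* The diagonal entry of [rho] at c is the sum of all |v c|^2, so its vanishing kills each term. *)
have vF v c : v \in vs -> c \notin F -> v c = 0.
  move=> vvs cF; move: (rhoF c cF); rewrite rhoE => /eqP.
  rewrite psumr_eq0; last by move=> u _; exact: mul_conjC_ge0.
  by move=> /allP/(_ v vvs) /=; rewrite mul_conjC_eq0 => /eqP.
(* The component of a Gram vector in block [u.1]; tuples of the wrong sum get the zero vector, so
   that the index runs over a full finite type. *)
pose w (u : {ffun 'I_N -> 'I_M.+1} * 'I_(size vs)) : vect R (config s m) :=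
  fun c => if (\sum_(j < N) (u.1 j : nat) == M)%N && in_block (fun j => u.1 j) c
           then nth (fun=> 0) vs u.2 c else 0.
apply: (@vacuum_mixture_separable _ _ _ _ _ F w) => //.
- by rewrite card_ord.
- move=> [n i] c cF; rewrite /w /=; case: ifP => // _.
  by rewrite vF ?mem_nth.
- move=> [n i]; rewrite /w /=.
  have [/eqP nM|_] := boolP (\sum_(j < N) (n j : nat) == M)%N; last first.
    by exists (Ordinal (ltnW N_ge2)) => c; rewrite eqxx.
  have [/existsP[j /eqP nj]|] := boolP [exists j, n j == ord0].
    exists j => c /=; case: ifP => [/forallP/(_ j)|]; last by rewrite eqxx.
    by rewrite nj => /eqP/particles_eq0.
  rewrite negb_exists => /forallP n0.
  (* Without a zero entry, N entries of at least 1 sum to M. *)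
  suff : (N <= M)%N by rewrite leqNgt ltMN.
  rewrite -[leqRHS]nM.
  rewrite -[X in (X <= _)%N](card_ord N) -sum1_card; apply: leq_sum => j _.
  by have := n0 j; rewrite -val_eqE /= -lt0n.
- move=> c d; rewrite effective_stateE rhoE.
  rewrite -(pair_bigA _ (fun n i => ketbra (w (n, i)) c d)) /= [LHS]big_mkcond.
  apply: eq_bigr => n _; rewrite (big_nth (fun=> 0)) big_mkord mulr_sumr.
  rewrite /ketbra /w /=; case: eqP => _ /=; last first.
    by rewrite big1 // => i _; rewrite mul0r.
  apply: eq_bigr => i _; case: in_block => /=; last by rewrite !mul0r.
  by case: in_block; rewrite ?rmorph0 ?mulr0 ?mul0r ?mul1r.
(* Trace preservation: a configuration of M particles lies in exactly one block, that of its own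
   local particle numbers [n0]. *)
have := rho1; rewrite (esum_finite_support uF) => [[<-]||x /rhoF -> //].
  rewrite !big_seq; apply: eq_bigr => c; rewrite inF => /eqP cM.
  rewrite effective_stateE -mulr_suml.
  have le j : (particles (c j) < M.+1)%N.
    by rewrite -cM ltnS /total_particles (bigD1 j) //= leq_addr.
  pose n0 : {ffun 'I_N -> 'I_M.+1} := [ffun j => Ordinal (le j)].
  rewrite (bigD1 n0) /=; last first.
    by rewrite -[X in _ == X]cM; apply/eqP/eq_bigr => j _; rewrite ffunE.
  rewrite andbb (_ : in_block (fun j => n0 j) c); last first.
    by apply/forallP => j; rewrite ffunE.
  rewrite big1 ?addr0 ?mul1r // => n /andP[_ nn0].
  rewrite andbb; case: (boolP (in_block _ c)) => // /forallP cn; case/eqP: nn0.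
  by apply/ffunP => j; apply: val_inj; rewrite ffunE /=; apply/esym/eqP.
by move=> x; have := positive_kernel_diag x rho_pos; rewrite lecE => /andP[].
Qed.
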